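(* Let $R$ be a commutative Noetherian local ring and $M$ a finitely generated torsion-free $R$-module with (constant) rank such that $E=\operatorname{End}_R(M)$ is a local ring (e.g. $R$ Henselian and $M$ indecomposable) and $E$ possesses an $R^*$-algebra structure. Suppose either (1) $R$ is a domain, or (2) $R$ is reduced of characteristic $2$. If the $R$-module $M_*\otimes_E M$ is torsion-free, then $M$ is a cyclic $E$-module.
   Context: An $R$-algebra $E$ (possibly noncommutative) is an $R^*$-algebra if there is a map of abelian groups $(-)^*:E\to E$ with $(ab)^*=b^*a^*$, $1_E^*=1_E$, $(ra)^*=ra^*$ for $r\in R$, and $a^{**}=a$ for all $a,b\in E$. $M$ is a left $E$-module via $f\cdot x=f(x)$, and $M_*$ denotes $M$ regarded as a right $E$-module via $x\cdot f=f^*(x)$. $M$ has rank $r$ if $M\otimes_R Q$ is free of rank $r$ over the total quotient ring $Q$ of $R$. An $R$-module is torsion-free if no nonzero element is annihilated by a nonzerodivisor of $R$. *)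

(* Defs.v *)
From HB Require Import structures.
From mathcomp Require Import all_boot all_order all_algebra.
Set Implicit Arguments. Unset Strict Implicit. Unset Printing Implicit Defensive.
Import GRing.Theory.
Local Open Scope ring_scope.

Section Defs.
Variable R : comUnitRingType.

Definition nzdiv (r : R) : Prop := forall a : R, r * a = 0 -> a = 0.

(* R is a local ring: the non-units form an additively closed set
   (R is nontrivial since it is a NzRing). *)
Definition local_comring : Prop :=
  forall a b : R, a \notin GRing.unit -> b \notin GRing.unit ->
    (a + b) \notin GRing.unit.

Definition ideal (I : R -> Prop) : Prop :=
  [/\ I 0, (forall x y, I x -> I y -> I (x + y)) &
      (forall r x, I x -> I (r * x))].

Definition noetherian : Prop :=
  forall I : R -> Prop, ideal I ->
    exists s : seq R, forall x, I x <->
      exists c : 'I_(size s) -> R, x = \sum_(i < size s) c i * s`_i.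

Definition is_domain : Prop := forall a b : R, a * b = 0 -> a = 0 \/ b = 0.
Definition reduced : Prop := forall (a : R) (n : nat), a ^+ n = 0 -> a = 0.
Definition char2 : Prop := (2%:R : R) = 0.

Variable M : lmodType R.

Definition fin_gen : Prop :=
  exists s : seq M, forall x : M,
    exists c : 'I_(size s) -> R, x = \sum_(i < size s) c i *: s`_i.

Definition torsion_free : Prop :=
  forall (r : R) (x : M), nzdiv r -> r *: x = 0 -> x = 0.

(* M has rank n: M (x)_R Q is Q-free of rank n, Q the total quotient ring.
   Written out: there are m_1..m_n in M whose images m_i/1 form a Q-basis
   of M (x)_R Q = S^-1 M (S = nonzerodivisors). *)
Definition has_rank (n : nat) : Prop :=
  exists m : 'I_n -> M,
    (forall (c : 'I_n -> R) (t : R), nzdiv t ->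
        t *: (\sum_(i < n) c i *: m i) = 0 -> forall i, c i = 0) /\
    (forall x : M, exists (s : R) (c : 'I_n -> R),
        nzdiv s /\ s *: x = \sum_(i < n) c i *: m i).

Definition endo (f : M -> M) : Prop :=
  forall (r : R) (x y : M), f (r *: x + y) = r *: f x + f y.

Definition endo_unit (f : M -> M) : Prop :=
  exists g : M -> M, endo g /\ (forall x, g (f x) = x) /\ (forall x, f (g x) = x).

Definition End_local : Prop :=
  (exists x : M, x != 0) /\
  forall f g : M -> M, endo f -> endo g -> ~ endo_unit f -> ~ endo_unit g ->
    ~ endo_unit (fun x => f x + g x).

Definition Rstar (star : (M -> M) -> (M -> M)) : Prop :=
  (forall f, endo f -> endo (star f)) /\
  (forall f g, endo f -> endo g -> forall x,
     star (fun y => f y + g y) x = star f x + star g x) /\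
  (forall f g, endo f -> endo g -> forall x,
     star (fun y => f (g y)) x = star g (star f x)) /\
  (forall x, star id x = x) /\
  (forall (r : R) f, endo f -> forall x,
     star (fun y => r *: f y) x = r *: star f x) /\
  (forall f, endo f -> forall x, star (star f) x = f x).

(* The tensor product M_* (x)_E M, where x . f = f^*(x).  The element
   sum_i x_i (x) y_i is zero iff it is killed by every E-balanced
   biadditive map (universal property of the tensor product). *)
Definition tensor_zero (star : (M -> M) -> (M -> M)) (s : seq (M * M)) : Prop :=
  forall (N : zmodType) (b : M -> M -> N),
    (forall x x' y, b (x + x') y = b x y + b x' y) ->
    (forall x y y', b x (y + y') = b x y + b x y') ->
    (forall f x y, endo f -> b (star f x) y = b x (f y)) ->
    \sum_(p <- s) b p.1 p.2 = 0.

Definition tensor_torsion_free (star : (M -> M) -> (M -> M)) : Prop :=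
  forall (r : R) (s : seq (M * M)), nzdiv r ->
    tensor_zero star [seq (r *: p.1, p.2) | p <- s] -> tensor_zero star s.

Definition cyclic_End : Prop :=
  exists x : M, forall y : M, exists f : M -> M, endo f /\ f x = y.

End Defs.

(* Main.v *)
(** Let [Q] be the total quotient ring of [R], [e] a rank-one idempotent of
    [End_Q(M (x) Q)] and [u = e^*].  The [Q]-module [u End_Q(M (x) Q) e] has
    rank one and is stable under the involution, which therefore acts on it as
    a scalar [eps]: [eps = 1] or [eps = -1] over a domain, and [eps = 1] over
    a reduced ring of characteristic 2.  Since [x (x) y] is a multiple of
    [m0 (x) g m0] for some [g] in this module, and [y (x) x] is the same
    multiple of [m0 (x) g^* m0], the element [x (x) y - eps y (x) x] is
    torsion, hence zero.  On the other hand, let [J] be the maximal ideal of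
    [E].  If a minimal set of generators of the [E]-module [M] contains two
    elements [x] and [y], then taking the coordinates [alpha] and [beta] of
    [M / J M] along them gives a balanced map
    [z (x) w |-> alpha(z)^* beta(w)] with values in [E / J], which separates
    [x (x) y] from [c (x) x] for every [c].

    Denominators are cleared throughout: [e = rank1 l0 m0] satisfies
    [e^2 = s e] with [s = l0 m0] a nonzerodivisor. *)
From HB Require Import structures.
Require Import Defs.
From mathcomp Require Import all_boot all_order all_algebra.
From mathcomp Require Import boolp functions.
Set Implicit Arguments. Unset Strict Implicit. Unset Printing Implicit Defensive.
Import GRing.Theory.
Local Open Scope ring_scope.

(** This serves to divide by the [Prop]-valued subgroup [Jrad]; [asbool] turns it into the boolean
    predicate that the quotient construction expects. *)
Lemma zmod_quotient (V : zmodType) (P : V -> Prop) :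
  P 0 -> (forall u v, P u -> P v -> P (u - v)) ->
  exists (N : zmodType) (q : {additive V -> N}), forall v, q v = 0 <-> P v.
Proof.
move=> P0 PB; pose S : {pred V} := [pred v | `[< P v >]].
have clS : zmod_closed S.
  split; first by apply/asboolP.
  by move=> u v /asboolP Pu /asboolP Pv; apply/asboolP; apply: PB.
pose mixin := GRing.isZmodClosed.Build V S clS.
pose I : zmodClosed V := HB.pack S mixin.
pose N : zmodType := Quotient.quot I.
pose q : {additive V -> N} := (\pi_(Quotient.quot I))%qT.
exists N, q => v; split.
- move=> qv0; apply/asboolP.
  have : v - 0 \in I by rewrite Quotient.idealrBE raddf0; apply/eqP.
  by rewrite subr0.
- move=> Pv; have : v - 0 \in I by rewrite subr0; apply/asboolP.
  by rewrite Quotient.idealrBE raddf0 => /eqP.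
Qed.

(** * Arithmetic of [R]-linear endomorphisms *)

Section Endomorphisms.
Variables (R : comUnitRingType) (M : lmodType R).
Implicit Types (f g h : M -> M) (r : R) (x y : M).

Lemma endoD f : endo f -> {morph f : x y / x + y}.
Proof. by move=> fE x y; rewrite -[x]scale1r fE !scale1r. Qed.

Lemma endo0 f : endo f -> f 0 = 0.
Proof. by move=> /endoD fD; apply: (addrI (f 0)); rewrite -fD !addr0. Qed.

Lemma endoZ f : endo f -> forall r x, f (r *: x) = r *: f x.
Proof. by move=> fE r x; rewrite -[r *: x]addr0 fE endo0 // !addr0. Qed.

Lemma endoN f : endo f -> {morph f : x / - x}.
Proof. by move=> fE x; rewrite -scaleN1r endoZ // scaleN1r. Qed.

Lemma endoB f : endo f -> {morph f : x y / x - y}.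
Proof. by move=> fE x y; rewrite endoD // endoN. Qed.

Lemma endo_sum f k (F : 'I_k -> M) : endo f ->
  f (\sum_(i < k) F i) = \sum_(i < k) f (F i).
Proof. by move=> fE; apply: (big_morph f (endoD fE) (endo0 fE)). Qed.

Lemma endo_id : endo (@id M). Proof. by []. Qed.

Lemma endo_zero : endo (0 : M -> M).
Proof. by move=> r x y; rewrite -[RHS]/(r *: 0 + 0) scaler0 addr0. Qed.

Lemma endo_comp f g : endo f -> endo g -> endo (f \o g).
Proof. by move=> fE gE r x y; rewrite /= gE fE. Qed.

Lemma endo_add f g : endo f -> endo g -> endo (f + g).
Proof. by move=> fE gE r x y; rewrite !fctE fE gE scalerDr addrACA. Qed.

Lemma endo_scale r f : endo f -> endo (r *: f).
Proof.
by move=> fE t x y; rewrite !fctE fE scalerDr !scalerA mulrC.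
Qed.

Lemma endo_opp f : endo f -> endo (- f).
Proof. by move=> fE r x y; rewrite !fctE fE opprD scalerN. Qed.

Lemma endo_sub f g : endo f -> endo g -> endo (f - g).
Proof. by move=> fE gE; apply: endo_add => //; apply: endo_opp. Qed.

Lemma endo_compBr f g h : endo f -> f \o (g - h) = (f \o g) - (f \o h).
Proof. by move=> fE; apply: funext => x; apply: (endoB fE). Qed.

Lemma endo_unit_id : endo_unit (@id M).
Proof. by exists id. Qed.

Lemma endo_unitN f : endo f -> endo_unit f -> endo_unit (- f).
Proof.
move=> fE [g [gE [gf fg]]]; exists (- g); split; first exact: endo_opp.
by split=> x; rewrite !fctE /= ?(endoN gE, endoN fE) opprK.
Qed.
End Endomorphisms.

(** * The maximal ideal of the local ring [E] *)

Section LocalEndomorphismRing.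
Variables (R : comUnitRingType) (M : lmodType R).
Hypothesis E_local : End_local M.
Implicit Types f g h : M -> M.

Definition Jrad f := endo f /\ ~ endo_unit f.

Lemma Jrad0 : Jrad 0.
Proof.
split; first exact: endo_zero.
case=> g [gE [gf _]]; case: E_local => -[x /eqP x0] _; apply: x0.
by rewrite -[x]gf endo0.
Qed.

Lemma JradB f g : Jrad f -> Jrad g -> Jrad (f - g).
Proof.
move=> [fE fJ] [gE gJ]; split; first exact: endo_sub.
apply: (E_local.2 f (- g)) => //; first exact: endo_opp.
by move=> /(endo_unitN (endo_opp gE)); rewrite opprK.
Qed.

(* [f \o g] is idempotent, and the idempotents of a local ring are 0 and 1. *)
Lemma local_inverse f g : endo f -> endo g -> g \o f = id -> f \o g = id.
Proof.
move=> fE gE gf1; have gf x : g (f x) = x := congr1 (@^~ x) gf1.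
have pE : endo (f \o g) by apply: endo_comp.
have qE : endo (id - (f \o g)) by apply: endo_sub.
have [[h [hE [hp ph]]]|np] := pselect (endo_unit (f \o g)).
  by apply/funext => x /=; rewrite -[in RHS](ph x) /= -[in LHS](ph x) /= gf.
have [[h [hE [hq qh]]]|nq] := pselect (endo_unit (id - (f \o g))).
  exfalso; case: E_local => -[x /eqP x0] _; apply: x0.
  rewrite -(gf x) -[f x](hq) !fctE /= gf subrr endo0 //.
  exact: endo0.
case: (E_local.2 _ _ pE qE np nq).
exists id; split=> //; split=> x; rewrite !fctE /=; exact: subrKC.
Qed.

(** If [h] inverts [f \o g], then [h \o f] is a left inverse of [g], hence a two-sided one by
    [local_inverse]. *)
Lemma Jrad_compl f g : endo f -> Jrad g -> Jrad (f \o g).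
Proof.
move=> fE [gE gJ]; split; first exact: endo_comp.
case=> h [hE [hfg _]]; apply: gJ; exists (h \o f).
split; first exact: endo_comp.
split=> //= x.
have := @local_inverse g (h \o f) gE (endo_comp hE fE).
by move=> /(_ (funext hfg)) /(congr1 (@^~ x)).
Qed.

Lemma Jrad_compr f g : Jrad f -> endo g -> Jrad (f \o g).
Proof.
move=> [fE fJ] gE; split; first exact: endo_comp.
case=> h [hE [_ fgh]]; apply: fJ; exists (g \o h).
split; first exact: endo_comp.
split=> //= x.
have := @local_inverse (g \o h) f (endo_comp gE hE) fE.
by move=> /(_ (funext fgh)) /(congr1 (@^~ x)).
Qed.

End LocalEndomorphismRing.

(** * The involution on [E] *)

Section Involution.
Variables (R : comUnitRingType) (M : lmodType R).
Variable star : (M -> M) -> (M -> M).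
Hypothesis star_axioms : Rstar star.
Implicit Types f g h : M -> M.

Lemma star_endo f : endo f -> endo (star f).
Proof. exact: star_axioms.1. Qed.

Lemma starK f : endo f -> star (star f) = f.
Proof. by move=> fE; apply: funext => x; apply: star_axioms.2.2.2.2.2. Qed.

Lemma starM f g : endo f -> endo g -> star (f \o g) = star g \o star f.
Proof. by move=> fE gE; apply: funext => x; apply: star_axioms.2.2.1. Qed.

Lemma star1 : star id = id.
Proof. by apply: funext => x; apply: star_axioms.2.2.2.1. Qed.

Lemma starD f g : endo f -> endo g -> star (f + g) = star f + star g.
Proof. by move=> fE gE; apply: funext => x; apply: star_axioms.2.1. Qed.

Lemma starZ r f : endo f -> star (r *: f) = r *: star f.
Proof. by move=> fE; apply: funext => x; apply: star_axioms.2.2.2.2.1. Qed.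

Lemma star0 : star 0 = 0.
Proof. by rewrite -(scale0r (0 : M -> M)) starZ ?scale0r //; apply: endo_zero. Qed.

Lemma starB f g : endo f -> endo g -> star (f - g) = star f - star g.
Proof.
move=> fE gE; have nE := endo_opp gE.
by rewrite starD // -(scaleN1r g) starZ // scaleN1r.
Qed.

Lemma star_unit f : endo f -> endo_unit (star f) -> endo_unit f.
Proof.
move=> fE [g [gE [gf fg]]]; exists (star g); split; first exact: star_endo.
have sE := star_endo fE.
have gf1 : g \o star f = id by apply: funext.
have fg1 : star f \o g = id by apply: funext.
split=> x; [move/(congr1 star): fg1 | move/(congr1 star): gf1].
- by rewrite starM // starK // star1 => /(congr1 (@^~ x)).
- by rewrite starM // starK // star1 => /(congr1 (@^~ x)).
Qed.

Lemma star_Jrad f : Jrad f -> Jrad (star f).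
Proof.
by move=> [fE fJ]; split; [apply: star_endo | move=> /(star_unit fE)].
Qed.

(** * Generators of [M] over [E], and independence modulo [Jrad] *)

Definition E_generated k (x : 'I_k -> M) :=
  forall z, exists F : 'I_k -> M -> M,
    (forall i, endo (F i)) /\ z = \sum_(i < k) F i (x i).

(** The invertible coefficient allows the relation to be solved for [x i], which is then substituted
    into every expansion. *)
Lemma drop_generator k (x : 'I_k.+1 -> M) (F : 'I_k.+1 -> M -> M) i :
  E_generated x -> (forall j, endo (F j)) -> \sum_(j < k.+1) F j (x j) = 0 ->
  endo_unit (F i) -> E_generated (x \o lift i).
Proof.
move=> gen_x FE sumF0 [h [hE [hF _]]] z.
have [G [GE ->]] := gen_x z.
exists (fun j => G (lift i j) - (G i \o h \o F (lift i j))); split=> [j|].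
  by apply: endo_sub => //; apply: endo_comp => //; apply: endo_comp.
rewrite (bigD1_ord i) //= -[x i]hF.
have -> : F i (x i) = - \sum_(j < k) F (lift i j) (x (lift i j)).
  by move: sumF0; rewrite (bigD1_ord i) //= => /eqP; rewrite addr_eq0 => /eqP.
rewrite (endoN hE) (endoN (GE i)) (endo_sum _ hE) (endo_sum _ (GE i)).
rewrite [LHS]addrC -sumrB.
apply: eq_bigr => j _ /=; congr (_ - _).
Qed.

Hypothesis E_local : End_local M.

(* [b z w = star (A z) \o B w] modulo [Jrad], where [A] and [B] are the first
   two coordinates along [x]; these are well defined modulo [Jrad] by [indep]. *)
Lemma independent_separated k (x : 'I_k.+2 -> M) :
  E_generated x ->
  (forall F, (forall i, endo (F i)) -> \sum_(i < k.+2) F i (x i) = 0 ->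
     forall i, Jrad (F i)) ->
  exists y z, forall c, ~ tensor_zero star [:: (y, z); (c, y)].
Proof.
move=> /choice[F Fgen] indep.
have FE z i : endo (F z i) := (Fgen z).1 i.
have Fx z : z = \sum_(i < k.+2) F z i (x i) := (Fgen z).2.
have F_uniq z G i : (forall j, endo (G j)) -> z = \sum_(j < k.+2) G j (x j) ->
    Jrad (F z i - G i).
  move=> GE zE; apply: (indep (fun j => F z j - G j)) => [j|].
    exact: endo_sub.
  by under eq_bigr do rewrite fctE; rewrite sumrB -Fx -zE subrr.
have delta i j : Jrad (F (x i) j - (if i == j then id else 0)).
  apply: (F_uniq (x i) (fun j => if i == j then id else 0)) => [l|].
    by case: eqP => // _; apply: endo_zero.
  rewrite (bigD1 i) //= eqxx big1 ?addr0 // => l /negPf li.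
  by rewrite eq_sym li.
(* [N] is the group of all maps [M -> M] modulo [Jrad]; it contains [E / J], where the values of [b]
   lie. *)
have [N [q q0]] := zmod_quotient (Jrad0 E_local) (JradB E_local).
have q_eq f g : Jrad (f - g) -> q f = q g.
  by move=> /q0; rewrite raddfB => /eqP; rewrite subr_eq0 => /eqP.
pose b z w := q (star (F z 0) \o F w 1).
have sE z i : endo (star (F z i)) by apply: star_endo.
have b_addl z z' w : b (z + z') w = b z w + b z' w.
  rewrite /b -raddfD; apply: q_eq.
  have -> : (star (F (z + z') 0) \o F w 1)
      - ((star (F z 0) \o F w 1) + (star (F z' 0) \o F w 1))
      = star (F (z + z') 0 - (F z 0 + F z' 0)) \o F w 1.
    by rewrite starB ?starD //; apply: endo_add.
  apply: Jrad_compr => //; apply: star_Jrad.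
  apply: (F_uniq (z + z') (fun i => F z i + F z' i)) => [i|].
    exact: endo_add.
  by rewrite {1}(Fx z) {1}(Fx z') -big_split.
have b_addr z w w' : b z (w + w') = b z w + b z w'.
  rewrite /b -raddfD; apply: q_eq.
  have -> : (star (F z 0) \o F w 1) + (star (F z 0) \o F w' 1)
      = star (F z 0) \o (F w 1 + F w' 1).
    by apply: funext => t; rewrite !fctE /= endoD.
  rewrite -endo_compBr //; apply: Jrad_compl => //.
  apply: (F_uniq (w + w') (fun i => F w i + F w' i)) => [i|].
    exact: endo_add.
  by rewrite {1}(Fx w) {1}(Fx w') -big_split.
have F_comp f z i : endo f -> Jrad (F (f z) i - (f \o F z i)).
  move=> fE; apply: (F_uniq (f z) (fun i => f \o F z i)) => [j|].
    exact: endo_comp.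
  by rewrite {1}(Fx z) endo_sum.
have b_balanced f z w : endo f -> b (star f z) w = b z (f w).
  move=> fE; have sfE := star_endo fE.
  transitivity (q (star (F z 0) \o f \o F w 1)); apply: q_eq.
    have -> : (star (F (star f z) 0) \o F w 1) - (star (F z 0) \o f \o F w 1)
        = star (F (star f z) 0 - (star f \o F z 0)) \o F w 1.
      by rewrite (starB (FE _ _) (endo_comp sfE (FE z 0))) starM // starK.
    apply: Jrad_compr => //.
    by apply: star_Jrad => //; apply: F_comp.
  have -> : (star (F z 0) \o f \o F w 1) - (star (F z 0) \o F (f w) 1)
      = star (F z 0) \o (- (F (f w) 1 - (f \o F w 1))).
    by rewrite opprB endo_compBr.
  apply: Jrad_compl => //; rewrite -[- _]add0r.
  by apply: JradB => //; [apply: Jrad0 | apply: F_comp].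
(* By [delta], [b c (x 0)] vanishes because coordinate 1 of [x 0] lies in [Jrad], while
   [b (x 0) (x 1)] is the class of [id], a unit. *)
exists (x 0), (x 1) => c /(_ N b b_addl b_addr b_balanced).
rewrite !big_cons big_nil addr0 /=.
have -> : b c (x 0) = 0.
  apply/q0; apply: Jrad_compl => //.
  by have := delta 0 1; rewrite subr0.
have -> : b (x 0) (x 1) = q id.
  apply: q_eq; set f := F _ 0; set g := F _ 1.
  have -> : (star f \o g) - id = (star f \o (g - id)) + star (f - id).
    rewrite (starB (FE _ _) (@endo_id _ _)) star1; apply: funext => t.
    by rewrite !fctE /= (endoB (sE _ _)) [RHS]addrA subrK.
  rewrite -[X in _ + X]opprK; apply: JradB => //.
    by apply: Jrad_compl; [|exact: sE|have := delta 1 1; rewrite eqxx].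
  rewrite -[- _]add0r; apply: JradB => //; first exact: Jrad0.
  by apply: star_Jrad; have := delta 0 0; rewrite eqxx.
by rewrite addr0 => /q0[_ []]; apply: endo_unit_id.
Qed.

(** Induction on the number of generators: with at least two, either a relation has a unit
    coefficient and a generator is dropped, or all relations have coefficients in [Jrad] and
    [independent_separated] contradicts the exchange. *)
Lemma cyclic_of_exchange : fin_gen M ->
  (forall x y, exists c, tensor_zero star [:: (x, y); (c, x)]) -> cyclic_End M.
Proof.
move=> [s s_gen] exch.
have: E_generated (fun i : 'I_(size s) => s`_i).
  move=> z; have [c ->] := s_gen z; exists (fun i => c i *: id); split=> // i.
  exact: endo_scale.
elim: (size s) (fun i : 'I__ => _) => [|k IHk] x gen_x.
  exists 0 => z; exists id; split=> //.
  by have [F [_ ->]] := gen_x z; rewrite big_ord0.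
case: k => [|k] in IHk x gen_x *.
  exists (x 0) => z; have [F [FE ->]] := gen_x z.
  by exists (F 0); rewrite big_ord1.
have [[F [i [FE [sum0 Fi]]]]|indep] := pselect (exists F i,
    (forall i, endo (F i)) /\ \sum_(i < k.+2) F i (x i) = 0 /\ endo_unit (F i)).
  exact: IHk (drop_generator gen_x FE sum0 Fi).
have [F FE sum0 i|y [z nyz]] := independent_separated gen_x.
  by split=> // Fi; apply: indep; exists F, i.
by have [c /nyz] := exch y z.
Qed.

End Involution.

(** * Linear functionals and rank-one endomorphisms *)

Section RankOne.
Variables (R : comUnitRingType) (M : lmodType R).
Implicit Types (r s : R) (l : M -> R) (x y z w : M).

Definition functional l := forall r x y, l (r *: x + y) = r * l x + l y.

Lemma functional0 l : functional l -> l 0 = 0.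
Proof.
move=> lF; have := lF 1 0 0; rewrite scale1r mul1r addr0.
by move=> /eqP; rewrite addrC -subr_eq subrr eq_sym => /eqP.
Qed.

Lemma functionalZ l r x : functional l -> l (r *: x) = r * l x.
Proof. by move=> lF; rewrite -[r *: x]addr0 lF functional0 // addr0. Qed.

Definition rank1 l x : M -> M := fun z => l z *: x.

Lemma rank1_endo l x : functional l -> endo (rank1 l x).
Proof. by move=> lF r y z; rewrite /rank1 lF scalerDl scalerA. Qed.

Lemma nzdivM r s : nzdiv r -> nzdiv s -> nzdiv (r * s).
Proof. by move=> rN sN a; rewrite -mulrA => /rN /sN. Qed.

Lemma nzdiv1 : nzdiv (1 : R).
Proof. by move=> a; rewrite mul1r. Qed.

Lemma domain_reduced : is_domain R -> reduced R.
Proof.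
move=> dom a; elim=> [|n IHn]; last by rewrite exprS => /dom[|/IHn].
by move=> /eqP; rewrite expr0 oner_eq0.
Qed.

Lemma reduced_sqr (a : R) : reduced R -> a * a = 0 -> a = 0.
Proof. by move=> red; rewrite -expr2; apply: red. Qed.

Lemma common_denominator n (m : 'I_n -> M) :
  (forall x, exists s (c : 'I_n -> R),
      nzdiv s /\ s *: x = \sum_(i < n) c i *: m i) ->
  fin_gen M ->
  exists2 s, nzdiv s & forall x, exists c : 'I_n -> R,
    s *: x = \sum_(i < n) c i *: m i.
Proof.
move=> span [gs gs_gen].
have [s sN sgs] : exists2 s, nzdiv s & forall x, x \in gs ->
    exists c : 'I_n -> R, s *: x = \sum_(i < n) c i *: m i.
  elim: gs {gs_gen} => [|g gs [s sN IHgs]]; first by exists 1; [exact: nzdiv1|].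
  have [t [c [tN tg]]] := span g.
  exists (t * s) => [|x]; first exact: nzdivM.
  rewrite inE => /orP[/eqP->|/IHgs[d sx]].
    exists (fun i => s * c i); rewrite mulrC -scalerA tg scaler_sumr.
    by apply: eq_bigr => i _; rewrite scalerA.
  exists (fun i => t * d i); rewrite -scalerA sx scaler_sumr.
  by apply: eq_bigr => i _; rewrite scalerA.
exists s => // x; have [c ->] := gs_gen x.
have /choice[d dE] : forall j : 'I_(size gs), exists d : 'I_n -> R,
    s *: gs`_j = \sum_(i < n) d i *: m i.
  by move=> j; apply: sgs; apply: mem_nth.
exists (fun i => \sum_(j < size gs) c j * d j i).
under [RHS]eq_bigr do rewrite scaler_suml.
rewrite exchange_big scaler_sumr; apply: eq_bigr => j _ /=.
rewrite scalerA mulrC -scalerA dE scaler_sumr.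
by apply: eq_bigr => i _; rewrite scalerA.
Qed.

(** Coordinates along the [m i], multiplied by a common denominator [s], are functionals defined on
    [M] itself. They separate points since [M] is torsion-free, and the [i]-th one sends [m i] to
    [s]. *)
Lemma enough_functionals n : (exists x : M, x != 0) ->
  fin_gen M -> torsion_free M -> has_rank M n ->
  (exists l m, functional l /\ nzdiv (l m)) /\
  (forall x, (forall l, functional l -> l x = 0) -> x = 0).
Proof.
move=> [x0 x0N] M_fg M_tf [m [m_free m_span]].
have [s sN /choice[p pE]] := common_denominator m_span M_fg.
have p_uniq x c i : s *: x = \sum_(i < n) c i *: m i -> p x i = c i.
  rewrite pE => E; apply/eqP; rewrite -subr_eq0; apply/eqP.
  apply: (m_free (fun i => p x i - c i) 1); first exact: nzdiv1.
  under eq_bigr do rewrite scalerBl.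
  by rewrite sumrB E subrr scaler0.
have pF i : functional (p^~ i).
  move=> r x y; apply: (p_uniq _ (fun i => r * p x i + p y i)).
  under eq_bigr do rewrite scalerDl -scalerA.
  by rewrite big_split /= -scaler_sumr -!pE scalerDr !scalerA mulrC.
have sep x : (forall i, p x i = 0) -> x = 0.
  move=> px0; apply: (M_tf s) => //; rewrite pE big1 // => i _.
  by rewrite px0 scale0r.
split; last by move=> x lx0; apply: sep => i; apply: (lx0 (p^~ i)).
(* If there were no coordinates, [sep] would give [x0 = 0]. *)
have [i _] : exists i : 'I_n, True.
  apply: contrapT => no_i; move/eqP: x0N; apply; apply: sep => i.
  by case: no_i; exists i.
exists (p^~ i), (m i); split=> //.
rewrite (p_uniq _ (fun j => if j == i then s else 0)) ?eqxx //.
rewrite (bigD1 i) //= eqxx big1 ?addr0 // => j /negPf ->.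
by rewrite scale0r.
Qed.

(** * The involution on the corner cut out by [u] and [e] *)

Variable star : (M -> M) -> (M -> M).
Hypothesis star_axioms : Rstar star.
Hypothesis R_reduced : reduced R.
Hypothesis M_torsion_free : torsion_free M.
Hypothesis separated : forall x, (forall l, functional l -> l x = 0) -> x = 0.
Variables (l0 : M -> R) (m0 : M).
Hypothesis l0F : functional l0.
Hypothesis l0m0_nzdiv : nzdiv (l0 m0).

Let s := l0 m0.
Let e := rank1 l0 m0.
Let u := star e.

Let eE : endo e. Proof. exact: rank1_endo. Qed.
Let uE : endo u. Proof. exact: star_endo. Qed.

Lemma scale_inj x y : s *: x = s *: y -> x = y.
Proof.
move=> sxy; apply/eqP; rewrite -subr_eq0; apply/eqP.
by apply: (M_torsion_free l0m0_nzdiv); rewrite scalerBr sxy subrr.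
Qed.

(** This is the image under [star] of the rank-one identity for [e \o star h \o e]. *)
Lemma star_corner h : endo h -> u \o h \o u = l0 (star h m0) *: u.
Proof.
move=> hE; have shE := star_endo star_axioms hE.
rewrite -(starZ star_axioms) // -[h in LHS](starK star_axioms) //.
rewrite /u -(starM star_axioms) // -(starM star_axioms) //; last exact: endo_comp.
congr star; apply: funext => z.
rewrite /= /e /rank1 (endoZ shE) (functionalZ _ _ l0F) !fctE.
by rewrite scalerA mulrC.
Qed.

(* For [h = rank1 l x] one has [u h u = c u], where [c] ought to be the trace
   [l (u x)] of [u h]; the difference [D] of the two satisfies [D^2 u = 0]. *)
Lemma star_rank_one l x w : functional l -> l (u w) *: u x = l (u x) *: u w.
Proof.
move=> lF; have hE := rank1_endo x lF.
set c := l0 (star (rank1 l x) m0).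
have cu y : l (u y) *: u x = c *: u y.
  have /(congr1 (@^~ y)) := star_corner hE.
  by rewrite /= /rank1 (endoZ uE).
pose D := c - l (u x).
have Dux : D *: u x = 0 by rewrite scalerBl -cu subrr.
have Dl : D * l (u x) = 0 by rewrite -functionalZ // Dux functional0.
have DDu : (D * D) *: u = 0.
  apply: funext => y; rewrite !fctE {2}/D mulrBr Dl subr0 -scalerA -cu.
  by rewrite scalerA mulrC -scalerA Dux scaler0.
have DDe : (D * D) *: e = 0.
  have := congr1 star DDu.
  by rewrite (starZ star_axioms) // (star0 star_axioms) (starK star_axioms).
(* Applying [l0] to the value of [DDe] at [m0] gives [D * D * s * s = 0]. *)
have D0 : D = 0.
  apply: reduced_sqr => //; apply: l0m0_nzdiv; apply: l0m0_nzdiv.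
  have /(congr1 (fun f => l0 (f m0))) := DDe.
  rewrite /e /rank1 !fctE !functionalZ // => E.
  by rewrite mulrA mulrC E; apply: functional0.
by rewrite cu -[c](subrK (l (u x))) -/D D0 add0r.
Qed.

(** The part of [E] inside [u End_Q e]: over [Q], [u / s] and [e / s] are idempotents, and they must
    fix [g] on the left and on the right. *)
Definition corner (g : M -> M) :=
  [/\ endo g, u \o g = s *: g & g \o e = s *: g].

Lemma corner_star g : corner g -> corner (star g).
Proof.
move=> [gE ug ge]; split; first exact: star_endo.
- by rewrite /u -(starM star_axioms) // ge (starZ star_axioms).
- by rewrite -[e](starK star_axioms) // -(starM star_axioms) // ug (starZ star_axioms).
Qed.

Lemma cornerB g h : corner g -> corner h -> corner (g - h).
Proof.
move=> [gE ug ge] [hE uh he]; split; first exact: endo_sub.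
- by rewrite endo_compBr // ug uh scalerBr.
- by rewrite -[LHS]/((g \o e) - (h \o e)) ge he scalerBr.
Qed.

Lemma corner_point g z : corner g -> s *: g z = l0 z *: g m0.
Proof.
move=> [gE _ ge]; have /(congr1 (@^~ z)) := ge.
by rewrite /= /e /rank1 (endoZ gE).
Qed.

(** Both maps are determined by their values at [m0]. These values are, up to the factor [s], in the
    image of [u], which has rank one by [star_rank_one]. *)
Lemma corner_exchange g h l : corner g -> corner h -> functional l ->
  l (h m0) *: g = l (g m0) *: h.
Proof.
move=> gC hC lF; apply: funext => z; rewrite !fctE; apply: scale_inj.
rewrite !scalerA ![s * _]mulrC -!scalerA !corner_point //.
rewrite !scalerA ![_ * l0 z]mulrC -!scalerA; congr (_ *: _).
have um f : corner f -> u (f m0) = s *: f m0.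
  by case=> _ uf _; apply: (congr1 (@^~ m0) uf).
have := star_rank_one (g m0) (h m0) lF; rewrite !um // !functionalZ // => E.
by apply: scale_inj; apply: scale_inj; move: E; rewrite !scalerA mulrAC [in RHS]mulrAC.
Qed.

Lemma corner_eq0 g : corner g -> (forall l, functional l -> l (g m0) = 0) -> g = 0.
Proof.
move=> gC /separated gm0; apply: funext => z; apply: scale_inj.
by rewrite corner_point // gm0 !scaler0.
Qed.

Lemma corner_sign : is_domain R \/ char2 R ->
  exists eps, forall g, corner g -> star g = eps *: g.
Proof.
have exch_star g h l : corner g -> corner h -> functional l ->
    l (h m0) *: star g = l (g m0) *: star h.
  move=> gC hC lF; have [gE _ _] := gC; have [hE _ _] := hC.
  have /(congr1 star) := corner_exchange gC hC lF.
  by rewrite !(starZ star_axioms).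
case=> [dom|two].
- have [[g [l [gC [lF lg]]]]|none] := pselect (exists g l,
      corner g /\ functional l /\ l (g m0) <> 0); last first.
    (* The corner is zero here, so any scalar works. *)
    exists 0 => g gC; have sgC := corner_star gC.
    rewrite scale0r; apply: corner_eq0 => // l lF.
    by apply: contrapT => lg; apply: none; exists (star g), l.
  have cancel (f h : M -> M) : l (g m0) *: f = l (g m0) *: h -> f = h.
    move=> E; apply: funext => z; apply/eqP; rewrite -subr_eq0; apply/eqP.
    apply: (M_torsion_free (r := l (g m0))) => [a /dom[]//|].
    by move/(congr1 (@^~ z)): E; rewrite !fctE scalerBr => ->; rewrite subrr.
  have sgC := corner_star gC.
  (* Exchanging [g] with [star g] and applying [star] shows that [l (star g m0)] and [l (g m0)] have
     equal squares. *)
  have sq : (l (star g m0) - l (g m0)) * (l (star g m0) + l (g m0)) = 0.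
    have := exch_star _ _ _ gC sgC lF; have [gE _ _] := gC.
    rewrite (starK star_axioms) // => /(congr1 (fun f => l (f m0))).
    by rewrite !fctE !functionalZ // => E; rewrite -subr_sqr !expr2 E subrr.
  have [eps epsE] : exists eps, l (star g m0) = eps * l (g m0).
    case: (dom _ _ sq) => /eqP.
    - by rewrite subr_eq0 => /eqP->; exists 1; rewrite mul1r.
    - by rewrite addr_eq0 => /eqP->; exists (-1); rewrite mulN1r.
  have sg : star g = eps *: g.
    apply: cancel; rewrite -(corner_exchange gC sgC lF) epsE scalerA.
    by rewrite mulrC.
  exists eps => h hC; apply: cancel.
  rewrite -(exch_star _ _ _ gC hC lF) sg scalerA mulrC -scalerA.
  by rewrite (corner_exchange gC hC lF) !scalerA mulrC.
- exists 1 => g gC; have sgC := corner_star gC; have [gE _ _] := gC.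
  rewrite scale1r; apply/eqP; rewrite -subr_eq0; apply/eqP.
  (* In characteristic 2, [d] is fixed by [star]. Exchanging it with [g], before and after [star],
     gives [l (d m0) *: d = 0], so [l (d m0)] has square zero. *)
  set d := star g - g; have dC : corner d by apply: cornerB.
  have sd : star d = d.
    rewrite (starB star_axioms) ?(starK star_axioms) //; last by case: sgC.
    have oppM z : - z = z :> M.
      apply/eqP; rewrite eq_sym -addr_eq0 -mulr2n -scaler_nat.
      by rewrite (two : 2%:R = 0) scale0r.
    by rewrite -opprB; apply: funext => z; apply: oppM.
  apply: corner_eq0 => // l lF; apply: reduced_sqr => //.
  have E1 := corner_exchange gC dC lF.
  have E2 := exch_star _ _ _ gC dC lF.
  have : l (d m0) *: d = 0 by rewrite {2}/d scalerBr E1 E2 sd subrr.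
  move=> /(congr1 (fun f => l (f m0))).
  by rewrite !fctE functionalZ // => ->; apply: functional0.
Qed.

Lemma tensor_exchange : is_domain R \/ char2 R -> tensor_torsion_free star ->
  exists eps, forall x y, tensor_zero star [:: (x, y); (- (eps *: y), x)].
Proof.
move=> /corner_sign[eps epsE] T_tf; exists eps => x y.
(* One factor [s] for each tensor argument: [s *: z] is the value at [m0] of [rank1 l0 z]. *)
apply: (T_tf (s * s)); first exact: nzdivM.
move=> N b b_addl b_addr b_bal.
rewrite !big_cons big_nil /= addr0.
have bZ r z w : b (r *: z) w = b z (r *: w).
  have idE : endo (r *: (@id M)) by apply: endo_scale.
  have := b_bal (r *: id) z w idE.
  by rewrite (starZ star_axioms) // (star1 star_axioms).
have fE z : endo (rank1 l0 z) by apply: rank1_endo.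
have fm z : rank1 l0 z m0 = s *: z by [].
have gC z w : corner (star (rank1 l0 z) \o rank1 l0 w).
  have sE := star_endo star_axioms (fE z).
  have fe t : rank1 l0 t \o e = s *: rank1 l0 t.
    apply: funext => v; rewrite !fctE /e /rank1 /= functionalZ //.
    by rewrite scalerA mulrC.
  split; first exact: endo_comp.
  - rewrite -[LHS]/((u \o star (rank1 l0 z)) \o rank1 l0 w).
    by rewrite -(starM star_axioms) // fe (starZ star_axioms).
  - rewrite -[LHS]/(star (rank1 l0 z) \o (rank1 l0 w \o e)) fe.
    by apply: funext => v; rewrite !fctE /= endoZ.
(* Balancedness moves [rank1 l0 z] across the tensor sign as its [star], leaving a corner element
   applied to [m0]. *)
have b_corner z w : b ((s * s) *: z) w =
    b m0 ((star (rank1 l0 z) \o rank1 l0 w) m0).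
  rewrite -scalerA bZ -!fm.
  have := b_bal _ m0 (rank1 l0 w m0) (star_endo star_axioms (fE z)).
  by rewrite (starK star_axioms).
have b0 w : b 0 w = 0 by apply: (addrI (b 0 w)); rewrite -b_addl !addr0.
have bN z w : b (- z) w = - b z w.
  by apply/eqP; rewrite -addr_eq0 -b_addl addNr b0.
have rank1Z : rank1 l0 (eps *: y) = eps *: rank1 l0 y.
  by apply: funext => v; rewrite !fctE /rank1 !scalerA mulrC.
rewrite scalerN bN !b_corner rank1Z (starZ star_axioms) //.
(* On this corner element [eps] acts as [star], which interchanges [x] and [y], so the two terms
   cancel. *)
rewrite -[_ \o _ in X in _ - X]/(eps *: (star (rank1 l0 y) \o rank1 l0 x)).
rewrite -epsE // (starM star_axioms (star_endo star_axioms (fE y)) (fE x)).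
by rewrite (starK star_axioms) // subrr.
Qed.

End RankOne.

(** * Cyclicity from the exchange relation *)

Theorem theorem3p6 (R : comUnitRingType) (M : lmodType R)
    (star : (M -> M) -> (M -> M)) (n : nat) :
  noetherian R -> local_comring R ->
  fin_gen M -> torsion_free M -> has_rank M n ->
  End_local M -> Rstar star ->
  (is_domain R \/ (reduced R /\ char2 R)) ->
  tensor_torsion_free star ->
  cyclic_End M.
Proof.
move=> _ _ M_fg M_tf M_rank E_local star_ax R_cases T_tf.
have [[l0 [m0 [l0F l0m0]]] sep] :=
  enough_functionals E_local.1 M_fg M_tf M_rank.
have R_red : reduced R by case: R_cases => [/domain_reduced|[]].
have R_cases' : is_domain R \/ char2 R by case: R_cases => [|[]]; [left|right].
have [eps exch] :=
  tensor_exchange star_ax R_red M_tf sep l0F l0m0 R_cases' T_tf.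
apply: (cyclic_of_exchange star_ax E_local M_fg) => x y.
by exists (- (eps *: y)); apply: exch.
Qed.
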